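(* Consider the vector field $F=(P,Q,R)$ on $\mathbb{R}^3$ with real coefficients defined by $$\begin{aligned} P(x,y,z)={}&-x+A_2y+a_1x^3+3a_2x^2y+3a_3xy^2+a_4y^3+3a_5x^2z+6a_6xyz+3a_7y^2z+3a_8xz^2+3a_9yz^2+a_{10}z^3,\\ Q(x,y,z)={}&-A_2x-y+b_1x^3+3b_2x^2y+3b_3xy^2+b_4y^3+3b_5x^2z+6b_6xyz+3b_7y^2z+3b_8xz^2+3b_9yz^2+b_{10}z^3,\\ R(x,y,z)={}&z\,(-1+3c_5x^2+6c_6xy+3c_7y^2+3c_8xz+3c_9yz+c_{10}z^2), \end{aligned}$$ where $$\begin{aligned} &a_8=\tfrac23-a_3,\quad a_{10}=\tfrac32(a_5-a_7),\\ &b_1=-3a_2+a_4+3b_3,\quad b_2=1-a_3-\tfrac{c_{10}}{3},\quad b_4=3-a_1-c_{10},\\ &b_6=\tfrac12(a_5-a_7),\quad b_7=2a_6+b_5,\quad b_8=2a_2-a_4-a_9-b_3,\\ &b_9=-\tfrac13+a_3+\tfrac{c_{10}}{3},\quad b_{10}=3a_6,\\ &c_5=-\tfrac23+\tfrac{a_1}{3}+a_3+\tfrac{c_{10}}{3},\quad c_6=\tfrac{2a_4}{3}-a_2+b_3,\quad c_7=\tfrac43-\tfrac{a_1}{3}-a_3-\tfrac{c_{10}}{3},\\ &c_8=\tfrac12(a_5+a_7),\quad c_9=a_6+b_5, \end{aligned}$$ and the remaining coefficients $A_2,a_1,\dots,a_7,a_9,b_3,b_5,c_{10}$ are arbitrary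 real numbers. Then $F$ has the density function $$\rho(x,y,z)=\frac{1}{(x^2+y^2+z^2)^2}.$$ Moreover, the plane $z=0$ is invariant, and the coefficients of $F$ can be chosen such that the divergence $\nabla\cdot F$ is positive on some nonempty open set.
   Context: A density function of a system $\dot x=F(x)$, where $F:\mathbb{R}^n\to\mathbb{R}^n$ is $C^1$ and $F(0)=0$, is a $C^1$ map $\rho:\mathbb{R}^n\setminus\{0\}\to[0,+\infty)$, integrable outside a ball centered at the origin, such that $[\nabla\cdot(\rho F)](x)>0$ for almost every $x\in\mathbb{R}^n$ (Lebesgue measure), where $\nabla\cdot(\rho F)=\nabla\rho\cdot F+\rho\,(\nabla\cdot F)$. Invariance of the plane $z=0$ refers to the flow of $(\dot x,\dot y,\dot z)=F(x,y,z)$. *)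

(* Defs.v *)
From HB Require Import structures.
From mathcomp Require Import all_boot all_order all_algebra.
From mathcomp Require Import all_classical all_reals all_analysis.
Import Order.TTheory GRing.Theory Num.Theory.
Import numFieldNormedType.Exports.

Set Implicit Arguments.
Unset Strict Implicit.
Unset Printing Implicit Defensive.

Local Open Scope classical_set_scope.
Local Open Scope ring_scope.

Section VectorCalculus.
Context {R : realType}.

(* The canonical norm of the product type is the sup norm; its topology is the
   usual one, but Euclidean balls need [enorm]. *)
Notation R3 := (R * R * R)%type.

Definition coordx (p : R3) : R := p.1.1.
Definition coordy (p : R3) : R := p.1.2.
Definition coordz (p : R3) : R := p.2.

Definition enorm (p : R3) : R :=
  Num.sqrt (coordx p ^+ 2 + coordy p ^+ 2 + coordz p ^+ 2).

Definition lebesgue3 :=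
  ((@lebesgue_measure R \x @lebesgue_measure R) \x @lebesgue_measure R)%E.

(* In finite dimension, continuity of all the maps [p |-> 'd f p v] is
   continuity of [p |-> 'd f p] for the operator norm. *)
Definition C1_on (V : normedModType R) (U : set R3) (f : R3 -> V) : Prop :=
  forall p, U p ->
    differentiable f p /\
    forall v : R3, {for p, continuous (fun q => 'd f q v)}.

Definition divergence (G : R3 -> R3) (p : R3) : R :=
  'D_((1, 0, 0) : R3) (coordx \o G) p +
  'D_((0, 1, 0) : R3) (coordy \o G) p +
  'D_((0, 0, 1) : R3) (coordz \o G) p.

Definition is_system (F : R3 -> R3) : Prop := C1_on setT F /\ F 0 = 0.

(* [rho] stands for a function on R^3 minus the origin: its value at 0 is
   never constrained. *)
Record density_function (F : R3 -> R3) (rho : R3 -> R) : Prop := {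
  density_system : is_system F ;
  density_C1 : C1_on [set p | p != 0] rho ;
  density_ge0 : forall p, p != 0 -> 0 <= rho p ;
  density_integrable : exists2 r : R, 0 < r &
    lebesgue3.-integrable [set p | r <= enorm p] (EFin \o rho) ;
  density_divergence : {ae lebesgue3, forall p : R3, p != 0 ->
    0 < divergence (fun q => rho q *: F q) p}
}.

Definition solution (F : R3 -> R3) (I : set R) (phi : R -> R3) : Prop :=
  forall t, I t -> is_derive t 1 phi (F (phi t)).

(* The flow of a C^1 field is only local, hence the quantification over all
   solutions with initial time 0, in both time directions. *)
Definition flow_invariant (F : R3 -> R3) (S : set R3) : Prop :=
  forall (I : set R) (phi : R -> R3),
    open I -> is_interval I -> I 0 -> solution F I phi ->
    S (phi 0) -> forall t, I t -> S (phi t).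

End VectorCalculus.

Record coefficients (R : realType) := Coefficients {
  A2 : R ;
  a1 : R ; a2 : R ; a3 : R ; a4 : R ; a5 : R ;
  a6 : R ; a7 : R ; a8 : R ; a9 : R ; a10 : R ;
  b1 : R ; b2 : R ; b3 : R ; b4 : R ; b5 : R ;
  b6 : R ; b7 : R ; b8 : R ; b9 : R ; b10 : R ;
  c5 : R ; c6 : R ; c7 : R ; c8 : R ; c9 : R ; c10 : R
}.

Section CubicField.
Context {R : realType}.
Variable k : coefficients R.

Definition fieldP (x y z : R) : R :=
  - x + A2 k * y + a1 k * x ^+ 3 + 3 * a2 k * x ^+ 2 * y
  + 3 * a3 k * x * y ^+ 2 + a4 k * y ^+ 3 + 3 * a5 k * x ^+ 2 * z
  + 6 * a6 k * x * y * z + 3 * a7 k * y ^+ 2 * z + 3 * a8 k * x * z ^+ 2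
  + 3 * a9 k * y * z ^+ 2 + a10 k * z ^+ 3.

Definition fieldQ (x y z : R) : R :=
  - A2 k * x - y + b1 k * x ^+ 3 + 3 * b2 k * x ^+ 2 * y
  + 3 * b3 k * x * y ^+ 2 + b4 k * y ^+ 3 + 3 * b5 k * x ^+ 2 * z
  + 6 * b6 k * x * y * z + 3 * b7 k * y ^+ 2 * z + 3 * b8 k * x * z ^+ 2
  + 3 * b9 k * y * z ^+ 2 + b10 k * z ^+ 3.

Definition fieldR (x y z : R) : R :=
  z * (- 1 + 3 * c5 k * x ^+ 2 + 6 * c6 k * x * y + 3 * c7 k * y ^+ 2
       + 3 * c8 k * x * z + 3 * c9 k * y * z + c10 k * z ^+ 2).

Definition field (p : R * R * R) : R * R * R :=
  let: (x, y, z) := p in (fieldP x y z, fieldQ x y z, fieldR x y z).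

Record coefficient_relations : Prop := {
  a8E : a8 k = 2 / 3 - a3 k ;
  a10E : a10 k = 3 / 2 * (a5 k - a7 k) ;
  b1E : b1 k = - 3 * a2 k + a4 k + 3 * b3 k ;
  b2E : b2 k = 1 - a3 k - c10 k / 3 ;
  b4E : b4 k = 3 - a1 k - c10 k ;
  b6E : b6 k = 1 / 2 * (a5 k - a7 k) ;
  b7E : b7 k = 2 * a6 k + b5 k ;
  b8E : b8 k = 2 * a2 k - a4 k - a9 k - b3 k ;
  b9E : b9 k = - (1 / 3) + a3 k + c10 k / 3 ;
  b10E : b10 k = 3 * a6 k ;
  c5E : c5 k = - (2 / 3) + a1 k / 3 + a3 k + c10 k / 3 ;
  c6E : c6 k = 2 * a4 k / 3 - a2 k + b3 k ;
  c7E : c7 k = 4 / 3 - a1 k / 3 - a3 k - c10 k / 3 ;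
  c8E : c8 k = 1 / 2 * (a5 k + a7 k) ;
  c9E : c9 k = a6 k + b5 k
}.

End CubicField.

Definition inverse_quartic (R : realType) (p : R * R * R) : R :=
  let: (x, y, z) := p in 1 / (x ^+ 2 + y ^+ 2 + z ^+ 2) ^+ 2.

(* Main.v *)
Require Import Defs.
From HB Require Import structures.
From mathcomp Require Import all_boot all_order all_algebra.
From mathcomp Require Import ring lra.
From mathcomp Require Import all_classical all_reals all_analysis.
From mathcomp Require Import measurable_realfun.
Import Order.TTheory GRing.Theory Num.Theory.
Import numFieldNormedType.Exports.
Local Open Scope classical_set_scope.
Local Open Scope ring_scope.

(** Write [s = x^2 + y^2 + z^2], so that [rho = s^-2] has gradient
    [-4 s^-3 p] at the point [p], and the product rule gives

      div (rho F) = s^-3 (s div F - 4 <p, F>).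

    The relations between the coefficients make the cubic part of the bracket
    collapse: [s div F - 4 <p, F> = s^2 + s] for every field of the family
    ([divergence_cofactor]).  The linear part
    contributes [s], and the cubic part [s^2].  Hence
    [div (rho F) = s^-1 + s^-2], which is positive at every point but the
    origin.

    Integrability of [rho] outside the unit ball is obtained by comparison
    with a product of functions of one variable.  If [s >= 1] then
    [(1 + |x|)^2 <= 4 s], and likewise for [y] and [z], so that the product of
    the three factors [1 + |x_i|] raised to the power [4/3] is at most
    [(4 s)^2].  Thus [rho <= 16 * \prod_i (1 + |x_i|)^(-4/3)]
    ([inverse_quartic_le]).  The exponent [4/3] shares the decay of degree 4
    evenly between the coordinates and exceeds 1, so that each factor is
    integrable over the line; Tonelli's theorem concludes.

    The plane [z = 0] is invariant because [R] is [z] times a continuous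
    function: along a solution, [z' = z g] with [g] continuous, and a
    Gronwall estimate on [z^2] shows that such a [z] vanishes identically as
    soon as it vanishes at time 0 ([linear_ode_zero]).

    Taking [a1 = 1] and all the other free coefficients zero, the divergence
    of [F] is [5 x^2 + 9 y^2 + z^2 - 3], which is positive for [x > 1]. *)

(** * Continuously differentiable maps *)

Section C1.
Context {R : realType}.
Local Notation R3 := (R * R * R)%type.
Implicit Types (U : set R3).

Lemma C1_cst (V : normedModType R) U (c : V) : C1_on U (fun=> c).
Proof.
move=> p _; split=> [|v]; first exact: differentiable_cst.
have -> : (fun q : R3 => 'd (fun=> c) q v) = cst 0.
  by apply/funext => q; rewrite diff_cst.
exact: cst_continuous.
Qed.

Lemma C1_linear (V : normedModType R) U (f : {linear R3 -> V}) :
  continuous f -> C1_on U f.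
Proof.
move=> cf p _; split=> [|v]; first exact: linear_differentiable.
have -> : (fun q : R3 => 'd f q v) = cst (f v).
  by apply/funext => q; rewrite diff_lin.
exact: cst_continuous.
Qed.

(** On an open set it is enough to know the differential on that set, since
    continuity at a point only involves the nearby values. *)
Lemma C1_from_diff (V : normedModType R) U (f : R3 -> V) (df : R3 -> R3 -> V) :
  open U ->
  (forall p, U p -> differentiable f p) ->
  (forall p v, U p -> 'd f p v = df v p) ->
  (forall p v, U p -> {for p, continuous (df v)}) ->
  C1_on U f.
Proof.
move=> oU dfU dfE cdf p Up; split=> [|v]; first exact: dfU.
have nU : nbhs p U by exact: open_nbhs_nbhs.
have e := dfE p v Up.
suff : (fun q : R3 => 'd f q v) @ p --> df v p by rewrite -e.
apply: cvg_trans (cdf p v Up); apply: near_eq_cvg.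
by near=> q; apply/esym/dfE; near: q.
Unshelve. all: by end_near. Qed.

Lemma C1D U (f g : R3 -> R) : open U -> C1_on U f -> C1_on U g ->
  C1_on U (fun p => f p + g p).
Proof.
move=> oU Cf Cg.
apply: (C1_from_diff _ U _ (fun v p => 'd f p v + 'd g p v)) => //
  p => [Up|v Up|v Up];
  have [df cf] := Cf _ Up; have [dg cg] := Cg _ Up.
- exact: differentiableD.
- exact: (congr1 (@^~ v) (diffD df dg)).
- exact: (continuousD (cf v) (cg v)).
Qed.

Lemma C1M U (f g : R3 -> R) : open U -> C1_on U f -> C1_on U g ->
  C1_on U (fun p => f p * g p).
Proof.
move=> oU Cf Cg.
apply: (C1_from_diff _ U _ (fun v p => f p * 'd g p v + g p * 'd f p v)) => //
  p => [Up|v Up|v Up];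
  have [df cf] := Cf _ Up; have [dg cg] := Cg _ Up.
- exact: differentiableM.
- exact: (congr1 (@^~ v) (diffM df dg)).
- have cf0 := differentiable_continuous df.
  have cg0 := differentiable_continuous dg.
  exact: (continuousD (continuousM cf0 (cg v)) (continuousM cg0 (cf v))).
Qed.

Lemma C1N (U : set R3) (f : R3 -> R) : open U -> C1_on U f ->
  C1_on U (fun p => - f p).
Proof.
move=> oU Cf; have -> : (fun p => - f p) = (fun p => (-1) * f p).
  by apply/funext => p; rewrite mulN1r.
have C1m1 : C1_on U (fun _ : R3 => -1 : R) by exact: C1_cst.
exact: (C1M U (fun=> -1) f oU C1m1 Cf).
Qed.

Lemma C1X U (f : R3 -> R) n : open U -> C1_on U f ->
  C1_on U (fun p => f p ^+ n).
Proof.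
move=> oU Cf; elim: n => [|n IHn]; first exact: C1_cst.
have -> : (fun p => f p ^+ n.+1) = (fun p => f p * f p ^+ n).
  by apply/funext => p; rewrite exprS.
by apply: C1M.
Qed.

Lemma C1V U (f : R3 -> R) : open U -> C1_on U f ->
  (forall p, U p -> f p != 0) ->
  C1_on U (fun p => (f p)^-1).
Proof.
move=> oU Cf f0.
apply: (C1_from_diff _ U _ (fun v p => - (f p) ^- 2 * 'd f p v)) => //
  p => [Up|v Up|v Up];
  have [df cf] := Cf _ Up.
- by apply: differentiableV => //; exact: f0.
- exact: (congr1 (@^~ v) (diffV df (f0 _ Up))).
- have cf0 := differentiable_continuous df.
  have cV : {for p, continuous (fun q => - (f q) ^- 2)}.
    apply: continuousN; apply: continuousV; first by rewrite expf_neq0 ?f0.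
    exact: (continuousM cf0 cf0).
  exact: (continuousM cV (cf v)).
Qed.

Lemma C1_pair (V W : normedModType R) U (f : R3 -> V) (g : R3 -> W) : open U ->
  C1_on U f -> C1_on U g -> C1_on U (fun p => (f p, g p)).
Proof.
move=> oU Cf Cg.
apply: (C1_from_diff _ U _ (fun v p => ('d f p v, 'd g p v))) => //
  p => [Up|v Up|v Up];
  have [df cf] := Cf _ Up; have [dg cg] := Cg _ Up.
- exact: differentiable_pair.
- exact: (congr1 (@^~ v) (diff_pair df dg)).
- exact: (cvg_pair (cf v) (cg v)).
Qed.

End C1.

(** * Coordinates and the squared Euclidean norm *)

Section Coordinates.
Context {R : realType}.
Local Notation R3 := (R * R * R)%type.

Fact coordx_is_linear : linear (@coordx R). Proof. by []. Qed.
Fact coordy_is_linear : linear (@coordy R). Proof. by []. Qed.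
Fact coordz_is_linear : linear (@coordz R). Proof. by []. Qed.

HB.instance Definition _ :=
  GRing.isLinear.Build R R3 R *:%R (@coordx R) coordx_is_linear.
HB.instance Definition _ :=
  GRing.isLinear.Build R R3 R *:%R (@coordy R) coordy_is_linear.
HB.instance Definition _ :=
  GRing.isLinear.Build R R3 R *:%R (@coordz R) coordz_is_linear.

Lemma coordx_continuous : continuous (@coordx R).
Proof. by move=> p; apply: continuous_comp; exact: cvg_fst. Qed.

Lemma coordy_continuous : continuous (@coordy R).
Proof.
move=> p; apply: (@continuous_comp _ _ _ fst snd); first exact: cvg_fst.
exact: cvg_snd.
Qed.

Lemma coordz_continuous : continuous (@coordz R).
Proof. by move=> p; exact: cvg_snd. Qed.

Lemma C1_coordx (U : set R3) : C1_on U (@coordx R).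
Proof. exact/C1_linear/coordx_continuous. Qed.

Lemma C1_coordy (U : set R3) : C1_on U (@coordy R).
Proof. exact/C1_linear/coordy_continuous. Qed.

Lemma C1_coordz (U : set R3) : C1_on U (@coordz R).
Proof. exact/C1_linear/coordz_continuous. Qed.

Lemma is_derive_linear (f : {linear R3 -> R}) (p v : R3) : continuous f ->
  is_derive p v f (f v).
Proof.
move=> cf; have df := linear_differentiable p cf.
by apply: DeriveDef; [exact: diff_derivable|rewrite deriveE// diff_lin].
Qed.

Lemma is_derive_coordx (p v : R3) :
  is_derive p v (@coordx R) (coordx v).
Proof. exact/is_derive_linear/coordx_continuous. Qed.

Lemma is_derive_coordy (p v : R3) :
  is_derive p v (@coordy R) (coordy v).
Proof. exact/is_derive_linear/coordy_continuous. Qed.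

Lemma is_derive_coordz (p v : R3) :
  is_derive p v (@coordz R) (coordz v).
Proof. exact/is_derive_linear/coordz_continuous. Qed.

Definition sqnorm (p : R3) : R := coordx p ^+ 2 + coordy p ^+ 2 + coordz p ^+ 2.

Lemma sqnorm_ge0 p : 0 <= sqnorm p.
Proof. by rewrite !addr_ge0 ?sqr_ge0. Qed.

Lemma sqnorm_neq0 p : p != 0 -> sqnorm p != 0.
Proof.
apply: contraNneq; case: p => [[x y] z].
rewrite /sqnorm /coordx /coordy /coordz /= => /eqP.
rewrite !paddr_eq0 ?addr_ge0 ?sqr_ge0// !sqrf_eq0.
by case/andP => /andP[/eqP-> /eqP->] /eqP->.
Qed.

Lemma inverse_quarticE : @inverse_quartic R = fun p => (sqnorm p ^+ 2)^-1.
Proof. by apply/funext => -[[x y] z]; rewrite /inverse_quartic div1r. Qed.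

Lemma open_neq0 : open [set p : R3 | p != 0].
Proof.
have -> : [set p : R3 | p != 0] = ~` [set 0].
  by apply/seteqP; split => p /=; move/eqP.
apply: closed_openC; apply: accessible_closed_set1.
exact/hausdorff_accessible/norm_hausdorff.
Qed.

End Coordinates.

(** Goes through the syntax of a polynomial expression in the coordinates;
    only the side conditions that the domain is open may remain. *)
Ltac C1_auto :=
  try exact: openT;
  lazymatch goal with
  | |- C1_on _ (fun p => (@?f p, @?g p)) => apply: C1_pair; C1_auto
  | |- C1_on _ (fun p => @?f p + @?g p) => apply: (C1D _ f g); C1_auto
  | |- C1_on _ (fun p => @?f p * @?g p) => apply: (C1M _ f g); C1_auto
  | |- C1_on _ (fun p => @?f p ^+ ?n) => apply: (C1X _ f); C1_auto
  | |- C1_on _ (fun=> ?c) => apply: C1_cst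
  | |- C1_on _ (fun p => coordx p) => exact: C1_coordx
  | |- C1_on _ (fun p => coordy p) => exact: C1_coordy
  | |- C1_on _ (fun p => coordz p) => exact: C1_coordz
  | |- C1_on _ (fun p => - @?f p) => apply: (C1N _ f); C1_auto
  | _ => idtac
  end.

Section FieldRegularity.
Context {R : realType}.
Local Notation R3 := (R * R * R)%type.

Lemma fieldE (k : coefficients R) : field k = fun p =>
  (Defs.fieldP k (coordx p) (coordy p) (coordz p),
   fieldQ k (coordx p) (coordy p) (coordz p),
   fieldR k (coordx p) (coordy p) (coordz p)).
Proof. by apply/funext => -[[]]. Qed.

Lemma C1_field (k : coefficients R) : C1_on setT (field k).
Proof. by rewrite fieldE /Defs.fieldP /fieldQ /fieldR; C1_auto. Qed.

Lemma C1_inverse_quartic : C1_on [set p | p != 0] (@inverse_quartic R).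
Proof.
have oU := @open_neq0 R.
rewrite inverse_quarticE; apply: C1V => // [|p p0].
  by rewrite /sqnorm; C1_auto.
by rewrite expf_neq0// sqnorm_neq0.
Qed.

End FieldRegularity.

(** * Divergence of the weighted field *)

(** These are the usual derivation rules for functions written pointwise, a
    form in which a polynomial expression can be traversed by syntax. *)
Section PointwiseDerivation.
Context {R : realType} {V : normedModType R}.
Implicit Types (f g : V -> R) (p v : V).

Lemma is_derive_fun_cst p v (c : R) : is_derive p v (fun=> c : R) 0.
Proof. exact: is_derive_cst. Qed.

Lemma is_derive_funD f g p v a b : is_derive p v f a -> is_derive p v g b ->
  is_derive p v (fun q => f q + g q) (a + b).
Proof. by move=> ? ?; exact: is_deriveD. Qed.

Lemma is_derive_funN f p v a : is_derive p v f a ->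
  is_derive p v (fun q => - f q) (- a).
Proof. by move=> ?; exact: is_deriveN. Qed.

Lemma is_derive_funM f g p v a b : is_derive p v f a -> is_derive p v g b ->
  is_derive p v (fun q => f q * g q) (f p * b + g p * a).
Proof. by move=> ? ?; exact: is_deriveM. Qed.

Lemma is_derive_funX f p v a n : is_derive p v f a ->
  is_derive p v (fun q => f q ^+ n.+1) (n.+1%:R * f p ^+ n * a).
Proof.
by move=> df; have := @is_deriveX _ _ f n.+1 _ _ _ df; rewrite exprfctE.
Qed.

Lemma is_derive_funV f p v a : f p != 0 -> is_derive p v f a ->
  is_derive p v (fun q => (f q)^-1) (- (f p) ^- 2 * a).
Proof.
by move=> f0 [df <-]; apply: DeriveDef; [exact: derivableV|rewrite deriveV].
Qed.

End PointwiseDerivation.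

Ltac is_derive_auto :=
  lazymatch goal with
  | |- is_derive _ _ (fun p => @?f p + @?g p) _ =>
      eapply (is_derive_funD f g); is_derive_auto
  | |- is_derive _ _ (fun p => @?f p * @?g p) _ =>
      eapply (is_derive_funM f g); is_derive_auto
  | |- is_derive _ _ (fun p => @?f p ^+ _) _ =>
      eapply (is_derive_funX f); is_derive_auto
  | |- is_derive _ _ (fun=> ?c) _ => eapply is_derive_fun_cst
  | |- is_derive _ _ (fun p => coordx p) _ => eapply is_derive_coordx
  | |- is_derive _ _ (fun p => coordy p) _ => eapply is_derive_coordy
  | |- is_derive _ _ (fun p => coordz p) _ => eapply is_derive_coordz
  | |- is_derive _ _ (fun p => - @?f p) _ =>
      eapply (is_derive_funN f); is_derive_auto
  | _ => idtac
  end.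

Section WeightedDivergence.
Context {R : realType}.
Local Notation R3 := (R * R * R)%type.
Implicit Types p : R3.

Lemma is_derive_sqnorm p v : is_derive p v (@sqnorm R)
  (2 * (coordx p * coordx v + coordy p * coordy v + coordz p * coordz v)).
Proof.
rewrite /sqnorm; apply: is_derive_eq; first is_derive_auto.
by rewrite !expr1; ring.
Qed.

(** The derivative of [s^-2] along [v] is [-4 s^-3 <p, v>]; the factor [s^-3]
    is taken out so that the three partial derivatives can be added. *)
Lemma is_derive_inverse_quarticM (g : R3 -> R) p v (dg : R) : p != 0 ->
  is_derive p v g dg ->
  is_derive p v (fun q => inverse_quartic q * g q)
   (sqnorm p ^- 3 * (sqnorm p * dg - 4 *
     (coordx p * coordx v + coordy p * coordy v + coordz p * coordz v) * g p)).
Proof.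
move=> p0 gE; have s0 := sqnorm_neq0 _ p0.
rewrite inverse_quarticE.
apply: is_derive_eq.
  eapply is_derive_funM; last exact: gE.
  eapply is_derive_funV; first by rewrite expf_neq0.
  eapply is_derive_funX; exact: is_derive_sqnorm.
by cbn beta; field.
Qed.

Lemma divergence_is_derive (G : R3 -> R3) p (a b c : R) :
  is_derive p ((1, 0, 0) : R3) (fun q => coordx (G q)) a ->
  is_derive p ((0, 1, 0) : R3) (fun q => coordy (G q)) b ->
  is_derive p ((0, 0, 1) : R3) (fun q => coordz (G q)) c ->
  divergence G p = a + b + c.
Proof. by move=> [_ <-] [_ <-] [_ <-]. Qed.

Section Field.
Variable k : coefficients R.

Definition dPdx p :=
  - 1 + 3 * a1 k * coordx p ^+ 2 + 6 * a2 k * coordx p * coordy p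
  + 3 * a3 k * coordy p ^+ 2 + 6 * a5 k * coordx p * coordz p
  + 6 * a6 k * coordy p * coordz p + 3 * a8 k * coordz p ^+ 2.

Definition dQdy p :=
  - 1 + 3 * b2 k * coordx p ^+ 2 + 6 * b3 k * coordx p * coordy p
  + 3 * b4 k * coordy p ^+ 2 + 6 * b6 k * coordx p * coordz p
  + 6 * b7 k * coordy p * coordz p + 3 * b9 k * coordz p ^+ 2.

Definition dRdz p :=
  - 1 + 3 * c5 k * coordx p ^+ 2 + 6 * c6 k * coordx p * coordy p
  + 3 * c7 k * coordy p ^+ 2 + 6 * c8 k * coordx p * coordz p
  + 6 * c9 k * coordy p * coordz p + 3 * c10 k * coordz p ^+ 2.

Lemma is_derive_field_x p :
  is_derive p ((1, 0, 0) : R3) (fun q => coordx (field k q)) (dPdx p).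
Proof.
rewrite fieldE; cbn [coordx fst snd]; rewrite /Defs.fieldP.
apply: is_derive_eq; first is_derive_auto.
by rewrite /dPdx !expr1 /coordx /coordy /coordz/=; ring.
Qed.

Lemma is_derive_field_y p :
  is_derive p ((0, 1, 0) : R3) (fun q => coordy (field k q)) (dQdy p).
Proof.
rewrite fieldE; cbn [coordy fst snd]; rewrite /fieldQ.
apply: is_derive_eq; first is_derive_auto.
by rewrite /dQdy !expr1 /coordx /coordy /coordz/=; ring.
Qed.

Lemma is_derive_field_z p :
  is_derive p ((0, 0, 1) : R3) (fun q => coordz (field k q)) (dRdz p).
Proof.
rewrite fieldE; cbn [coordz fst snd]; rewrite /fieldR.
apply: is_derive_eq; first is_derive_auto.
by rewrite /dRdz !expr1 /coordx /coordy /coordz/=; ring.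
Qed.

Lemma divergence_field p : divergence (field k) p = dPdx p + dQdy p + dRdz p.
Proof.
apply: divergence_is_derive.
- exact: is_derive_field_x.
- exact: is_derive_field_y.
- exact: is_derive_field_z.
Qed.

(** The identity behind the choice of the coefficients: the cubic part of the
    left-hand side, a quartic form in [x, y, z] depending on eleven
    parameters, reduces to [s^2]. *)
Lemma divergence_cofactor p : coefficient_relations k ->
  sqnorm p * divergence (field k) p -
    4 * (coordx p * coordx (field k p) + coordy p * coordy (field k p) +
         coordz p * coordz (field k p)) =
  sqnorm p ^+ 2 + sqnorm p.
Proof.
case=> e1 e2 e3 e4 e5 e6 e7 e8 e9 e10 e11 e12 e13 e14 e15.
rewrite divergence_field fieldE; cbn [coordx coordy coordz fst snd].
rewrite /dPdx /dQdy /dRdz /Defs.fieldP /fieldQ /fieldR /sqnorm.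
rewrite e1 e2 e3 e4 e5 e6 e7 e8 e9 e10 e11 e12 e13 e14 e15.
by field.
Qed.

Lemma divergence_weighted_field p : coefficient_relations k -> p != 0 ->
  divergence (fun q => inverse_quartic q *: field k q) p =
  (sqnorm p)^-1 + sqnorm p ^- 2.
Proof.
move=> kr p0; have s0 := sqnorm_neq0 _ p0.
have dx := is_derive_inverse_quarticM _ _ _ _ p0 (is_derive_field_x p).
have dy := is_derive_inverse_quarticM _ _ _ _ p0 (is_derive_field_y p).
have dz := is_derive_inverse_quarticM _ _ _ _ p0 (is_derive_field_z p).
rewrite (divergence_is_derive (fun q => inverse_quartic q *: field k q)
  _ _ _ _ dx dy dz).
transitivity (sqnorm p ^- 3 * (sqnorm p ^+ 2 + sqnorm p)); last by field.
rewrite -(divergence_cofactor p kr) divergence_field /coordx /coordy /coordz /=.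
by ring.
Qed.

End Field.

End WeightedDivergence.

(** * A field with positive divergence somewhere *)

Section PositiveDivergence.
Context {R : realType}.
Local Notation R3 := (R * R * R)%type.

(** The only nonzero free coefficient is [a1]; the others are forced. *)
Definition a1_coefficients : coefficients R :=
 {| A2 := 0; a1 := 1; a2 := 0; a3 := 0; a4 := 0; a5 := 0; a6 := 0; a7 := 0;
   a8 := 2 / 3; a9 := 0; a10 := 0; b1 := 0; b2 := 1; b3 := 0; b4 := 2; b5 := 0;
   b6 := 0; b7 := 0; b8 := 0; b9 := - (1 / 3); b10 := 0;
   c5 := - (1 / 3); c6 := 0; c7 := 1; c8 := 0; c9 := 0; c10 := 0 |}.

Lemma a1_coefficients_relations : coefficient_relations a1_coefficients.
Proof. by split => /=; field. Qed.

Lemma divergence_a1_field (p : R3) :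
  divergence (field a1_coefficients) p =
  5 * coordx p ^+ 2 + 9 * coordy p ^+ 2 + coordz p ^+ 2 - 3.
Proof. by rewrite divergence_field /dPdx /dQdy /dRdz /=; field. Qed.

Lemma positive_divergence_ex :
  exists k : coefficients R, coefficient_relations k /\
    exists U : set R3,
      [/\ open U, U !=set0 & forall p, U p -> 0 < divergence (field k) p].
Proof.
exists a1_coefficients; split; first exact: a1_coefficients_relations.
exists [set p | 1 < coordx p]; split.
- apply: (open_comp (f := @coordx R) (D := [set x | 1 < x])) => [p _|].
    exact: coordx_continuous.
  exact: open_gt.
- by exists (2, 0, 0); rewrite /= /coordx/= ltr1n.
- move=> p /= x1; rewrite divergence_a1_field.
  have : 0 <= coordy p ^+ 2 by exact: sqr_ge0.
  have : 0 <= coordz p ^+ 2 by exact: sqr_ge0.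
  nra.
Qed.

End PositiveDivergence.

(** * Integrability away from the origin *)

(** By Tonelli's theorem; used twice, this reduces an integral over space to
    integrals over the line. *)
Lemma ge0_integral_prodM d1 d2 (T1 : measurableType d1)
  (T2 : measurableType d2) (R : realType)
  (m1 : {sigma_finite_measure set T1 -> \bar R})
  (m2 : {sigma_finite_measure set T2 -> \bar R}) (f : T1 -> R) (g : T2 -> R) :
  measurable_fun setT f -> measurable_fun setT g ->
  (forall x, 0 <= f x) -> (forall y, 0 <= g y) ->
  (\int[m1 \x m2]_p (f p.1 * g p.2)%:E =
   \int[m1]_x (f x)%:E * \int[m2]_y (g y)%:E)%E.
Proof.
move=> mf mg f0 g0; rewrite fubini_tonelli1/=; last 2 first.
- apply/measurable_EFinP; apply: measurable_funM; exact: measurableT_comp.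
- by move=> p; rewrite lee_fin mulr_ge0.
rewrite -ge0_integralZr//=; last 3 first.
- exact/measurable_EFinP.
- by move=> x _; rewrite lee_fin.
- by apply: integral_ge0 => y _; rewrite lee_fin.
apply: eq_integral => x _; rewrite /fubini_F/=.
under eq_integral do rewrite EFinM.
rewrite ge0_integralZl//=.
- exact/measurable_EFinP.
- by move=> y _; rewrite lee_fin.
- by rewrite lee_fin.
Qed.

Section Integrability.
Context {R : realType}.
Local Notation R3 := (R * R * R)%type.
Local Notation mu := (@lebesgue_measure R).

(** The exponent leaves [decay] integrable, and the shift by 1 keeps it bounded
    near 0 while preserving an elementary antiderivative on each half-line. *)
Definition decay (x : R) : R := (1 + `|x|) `^ (- (4 / 3)).

Lemma decay_ge0 x : 0 <= decay x. Proof. exact: powR_ge0. Qed.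

Lemma decay_even : decay =1 decay \o -%R.
Proof. by move=> x; rewrite /decay /= normrN. Qed.

Lemma continuous_powR (a x : R) : 0 < x -> {for x, continuous (@powR R ^~ a)}.
Proof.
move=> x0; apply: differentiable_continuous; apply/derivable1_diffP.
by have [] := @is_derive1_powR _ a _ x0.
Qed.

Lemma decay_continuous : continuous decay.
Proof.
move=> x.
have c1 : {for x, continuous (fun y : R => 1 + `|y|)}.
  have cn : {for x, continuous (fun y : R => `|y|)} by exact: norm_continuous.
  exact: (continuousD (@cst_continuous _ _ (1 : R) x) cn).
have c2 : {for 1 + `|x|, continuous (@powR R ^~ (- (4 / 3)))}.
  by apply: continuous_powR; rewrite ltr_wpDr.
exact: (continuous_comp c1 c2).
Qed.

Lemma measurable_decay : measurable_fun setT decay.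
Proof. exact: continuous_measurable_fun decay_continuous. Qed.

(** An antiderivative on the half-line [x >= 0] only; evenness of [decay] takes
    care of the other half. *)
Definition decay_primitive (x : R) : R := - 3 * (1 + x) `^ (- (1 / 3)).

Lemma is_derive_decay_primitive (x : R) : 0 <= x ->
  is_derive x 1 decay_primitive (decay x).
Proof.
move=> x0; have x1 : 0 < 1 + x by rewrite ltr_wpDr.
have d1 : is_derive x 1 (fun y : R => 1 + y) 1.
  have := is_deriveD (is_derive_cst (1 : R) x 1) (is_derive_id x 1).
  by rewrite add0r.
have d2 := is_derive1_comp (@is_derive1_powR _ (- (1 / 3)) _ x1) d1.
apply: (is_derive_eq (is_deriveZ (-3 : R) d2)).
rewrite /GRing.scale/= /decay ger0_norm// mulr1 mulrA.
have -> : - (1 / 3) - 1 = - (4 / 3) :> R by field.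
have -> : - 3 * - (1 / 3) = 1 :> R by field.
by rewrite mul1r.
Qed.

Lemma decay_primitive_cvg : decay_primitive x @[x --> +oo] --> 0.
Proof.
have root_y : (fun x : R => (1 + x) `^ (1 / 3)) x @[x --> +oo%R] --> +oo%R.
  (* [(1 + x)^(1/3) >= A] as soon as [1 + x >= max(A, 0)^3]. *)
  apply/cvgryPge => A; near=> x.
  apply: (@le_trans _ _ (Num.max A 0)); first by rewrite le_max lexx.
  have m0 : 0 <= Num.max A 0 by rewrite le_max lexx orbT.
  have -> : Num.max A 0 = (Num.max A 0 ^+ 3) `^ (1 / 3).
    have e : 3%:R * (1 / 3) = 1 :> R by field.
    by rewrite -powR_mulrn// -powRrM e powRr1.
  have x0 : Num.max A 0 ^+ 3 <= 1 + x.
    by rewrite -lerBlDl; near: x; apply: nbhs_pinfty_ge; rewrite num_real.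
  have m3 := exprn_ge0 3 m0.
  have x1 := le_trans m3 x0.
  by apply: ge0_ler_powR; rewrite ?nnegrE.
have root_gt0 : \forall x \near +oo%R, 0 < (1 + x : R) `^ (1 / 3).
  apply: filterS (nbhs_pinfty_ge (num_real (0 : R))) => x x0.
  by apply: powR_gt0; rewrite ltr_wpDr.
have root_V0 :
    (fun x : R => ((1 + x) `^ (1 / 3))^-1) x @[x --> +oo%R] --> (0 : R).
  exact: (gtr0_cvgV0 root_gt0).2.
have -> : decay_primitive = fun x => - 3 * ((1 + x) `^ (1 / 3))^-1.
  by apply/funext => x; rewrite /decay_primitive powRN.
by rewrite -[X in _ --> X](mulr0 (-3 : R)); exact: cvgM (cvg_cst _) root_V0.
Unshelve. all: by end_near. Qed.

Lemma integral_decay : (\int[mu]_x (decay x)%:E = 6%:E)%E.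
Proof.
rewrite (ge0_symfun_integralT decay_ge0 decay_continuous decay_even).
rewrite -set_itvcy (@ge0_continuous_FTC2y _ decay decay_primitive 0 0).
- rewrite /decay_primitive addr0 powR1 mulr1 -EFinB sub0r opprK -EFinM.
  by congr (_%:E); ring.
- by move=> x _; exact: decay_ge0.
- exact: continuous_subspaceT decay_continuous.
- exact: decay_primitive_cvg.
- by move=> x /ltW/is_derive_decay_primitive[].
- apply: cvg_at_right_filter; apply: differentiable_continuous.
  by apply/derivable1_diffP; have [] := is_derive_decay_primitive 0 (lexx 0).
- move=> x; rewrite in_itv/= andbT => /ltW/is_derive_decay_primitive[_].
  by rewrite derive1E.
Qed.

Definition decay3 (p : R3) : R := decay p.1.1 * decay p.1.2 * decay p.2.

Lemma measurable_decay3 : measurable_fun setT decay3.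
Proof.
apply: measurable_funM; first apply: measurable_funM.
- by apply: (measurableT_comp measurable_decay); apply: measurableT_comp.
- by apply: (measurableT_comp measurable_decay); apply: measurableT_comp.
- by apply: (measurableT_comp measurable_decay).
Qed.

Lemma decay3_ge0 p : 0 <= decay3 p.
Proof. by rewrite !mulr_ge0 ?decay_ge0. Qed.

(** A name for the planar measure carries its sigma-finite structure, which
    a second use of Tonelli's theorem requires. *)
Definition plane_measure := (mu \x mu)%E.

Lemma plane_measure_sigma_finite : sigma_finite setT plane_measure.
Proof.
have /sigma_finiteP[F [FT ndF Foo]] := sigma_finiteT mu.
(* A common exhaustion of both axes gives an exhaustion by squares. *)
exists (fun n => F n `*` F n) => [|n].
  apply/seteqP; split => // -[x y] _.
  have [m _ Fmx] : (\bigcup_i F i) x by rewrite -FT.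
  have [n _ Fny] : (\bigcup_i F i) y by rewrite -FT.
  exists (maxn m n) => //; split => /=.
    by apply: (subsetPset _ _ (ndF _ _ (leq_maxl m n))).
  by apply: (subsetPset _ _ (ndF _ _ (leq_maxr m n))).
have [mF Fn] := Foo n; split; first exact: measurableX.
by rewrite /plane_measure product_measure1E// lte_mul_pinfty// ge0_fin_numE.
Qed.

HB.instance Definition _ := Measure.on plane_measure.
HB.instance Definition _ := Measure_isSigmaFinite.Build _ _ _ plane_measure
  plane_measure_sigma_finite.

Lemma integral_decay3_lty : (\int[lebesgue3]_p (decay3 p)%:E < +oo)%E.
Proof.
have mdd : measurable_fun setT (fun q : R * R => decay q.1 * decay q.2).
  by apply: measurable_funM; apply: (measurableT_comp measurable_decay).
have dd0 (q : R * R) : 0 <= decay q.1 * decay q.2.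
  by rewrite mulr_ge0 ?decay_ge0.
have E1 := @ge0_integral_prodM _ _ _ _ _ mu mu decay decay
  measurable_decay measurable_decay decay_ge0 decay_ge0.
have E2 := @ge0_integral_prodM _ _ _ _ _ plane_measure mu _ decay
  mdd measurable_decay dd0 decay_ge0.
suff : (\int[plane_measure \x mu]_p (decay3 p)%:E < +oo)%E by [].
by rewrite [ltLHS]E2 [X in (X * _)%E]E1 integral_decay -!EFinM ltry.
Qed.

(** Reduces the measurability of [rho] to that of real powers.  The equality
    extends to the origin, where both sides are 0 by convention. *)
Lemma inverse_quartic_powR p : inverse_quartic p = (@sqnorm R p) `^ (- 2%:R).
Proof. by rewrite inverse_quarticE powR_invn// sqnorm_ge0. Qed.

(** With [m] the product of the [1 + |x_i|], the bound reads
    [m^(4/3) <= 16 s^2], that is, [(m^2)^(2/3) <= ((4 s)^3)^(2/3)].  Each factor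
    satisfies [(1 + |x_i|)^2 <= 2 (1 + x_i^2) <= 4 s] because [s >= 1]. *)
Lemma inverse_quartic_le p : 1 <= sqnorm p ->
  inverse_quartic p <= 16 * decay3 p.
Proof.
move=> s1; have s0 : 0 < sqnorm p by apply: lt_le_trans s1.
pose m := (1 + `|coordx p|) * (1 + `|coordy p|) * (1 + `|coordz p|).
have mE : decay3 p = m `^ (- (4 / 3)).
  by rewrite /decay3 /decay /m !powRM ?mulr_ge0 ?addr_ge0.
have m0 : 0 < m by rewrite !mulr_gt0// ltr_wpDr.
have m2 : m ^+ 2 <= (4 * sqnorm p) ^+ 3.
  have b (x : R) : x ^+ 2 <= sqnorm p -> (1 + `|x|) ^+ 2 <= 4 * sqnorm p.
    rewrite -(real_normK (num_real x)) => xs.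
    have : 0 <= (1 - `|x|) ^+ 2 by exact: sqr_ge0.
    nra.
  have [bx by_ bz] : [/\ coordx p ^+ 2 <= sqnorm p,
      coordy p ^+ 2 <= sqnorm p & coordz p ^+ 2 <= sqnorm p].
    have := sqr_ge0 (coordx p); have := sqr_ge0 (coordy p).
    have := sqr_ge0 (coordz p).
    by rewrite /sqnorm => ? ? ?; split; lra.
  have -> : (4 * sqnorm p) ^+ 3 =
      4 * sqnorm p * (4 * sqnorm p) * (4 * sqnorm p) by ring.
  rewrite /m 2!exprMn.
  apply: ler_pM; rewrite ?mulr_ge0 ?sqr_ge0 ?b//.
  by apply: ler_pM; rewrite ?sqr_ge0 ?b.
have m43 : m `^ (4 / 3) <= 16 * sqnorm p ^+ 2.
  have -> : m `^ (4 / 3) = (m ^+ 2) `^ (2 / 3).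
    have -> : 4 / 3 = 2%:R * (2 / 3) :> R by field.
    by rewrite powRrM powR_mulrn// ltW.
  have -> : 16 * sqnorm p ^+ 2 = ((4 * sqnorm p) ^+ 3) `^ (2 / 3).
    have s4 : 0 <= 4 * sqnorm p by rewrite mulr_ge0// ltW.
    rewrite -[X in _ = X `^ _]powR_mulrn// -powRrM.
    have -> : 3%:R * (2 / 3) = 2%:R :> R by field.
    by rewrite powR_mulrn//; ring.
  apply: ge0_ler_powR => //; rewrite nnegrE ?sqr_ge0//.
  by rewrite exprn_ge0// mulr_ge0// ltW.
rewrite mE powRN inverse_quarticE ler_pdivlMr ?powR_gt0// mulrC.
by rewrite ler_pdivrMr ?exprn_gt0.
Qed.

Lemma measurable_sqnorm : measurable_fun setT (@sqnorm R).
Proof.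
apply: measurable_funD; first apply: measurable_funD;
  apply: measurable_funX => //.
- exact: (measurableT_comp measurable_fst measurable_fst).
- exact: (measurableT_comp measurable_snd measurable_fst).
- exact: measurable_snd.
Qed.

Lemma integrable_inverse_quartic :
  lebesgue3.-integrable [set p | 1 <= enorm p] (EFin \o @inverse_quartic R).
Proof.
have enormE p : (1 <= enorm p) = (1 <= sqnorm p).
  by rewrite -[X in X <= _]sqrtr1 ler_sqrt// sqnorm_ge0.
have mD : measurable [set p : R3 | 1 <= enorm p].
  have -> : [set p : R3 | 1 <= enorm p] = setT `&` (@sqnorm R) @^-1` `[1, +oo[.
    by apply/seteqP; split => p /=; rewrite enormE in_itv/= andbT => // -[].
  exact: measurable_sqnorm.
have miq : measurable_fun setT (@inverse_quartic R).
  have -> : @inverse_quartic R = (fun x => x `^ (- 2%:R)) \o (@sqnorm R).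
    by apply/funext => p; rewrite inverse_quartic_powR.
  exact: (measurableT_comp (measurable_powR _) measurable_sqnorm).
apply: (@le_integrable _ _ _ lebesgue3 _ mD _
  (fun p => 16%:E * (decay3 p)%:E)%E).
- by apply/measurable_EFinP; exact: measurable_funTS.
- move=> p /=; rewrite enormE => s1; rewrite lee_fin.
  rewrite ger0_norm; last by rewrite inverse_quartic_powR powR_ge0.
  rewrite ger0_norm; last by rewrite mulr_ge0// decay3_ge0.
  exact: inverse_quartic_le.
apply: integrableZl => //.
apply: (@integrableS _ _ _ _ setT) => //.
apply/integrableP; split.
  by apply/measurable_EFinP; exact: measurable_decay3.
under eq_integral => p _ do rewrite /= ger0_norm ?decay3_ge0//.
exact: integral_decay3_lty.
Qed.

End Integrability.

(** * Invariance of the plane *)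

Section Invariance.
Context {R : realType}.
Local Notation R3 := (R * R * R)%type.

(** Gronwall's argument: with [M] an upper bound of [g] on [[0, T]], the
    function [z^2 exp (-2 M t)] has derivative
    [2 z^2 (g - M) exp (-2 M t) <= 0]; it is nonnegative and vanishes at 0. *)
Lemma linear_ode_forward (z g : R -> R) (T : R) : 0 <= T ->
  (forall t, 0 <= t <= T -> is_derive t 1 z (z t * g t)) ->
  (forall t, 0 <= t <= T -> {for t, continuous g}) ->
  z 0 = 0 -> z T = 0.
Proof.
move=> T0 dz cg z0.
have cgw : {within `[0, T], continuous g}.
  apply: continuous_in_subspaceT => t /set_mem /=.
  by rewrite in_itv/=; exact: cg.
have [c cT gM] := EVT_max T0 cgw.
pose M := g c.
pose w t := z t ^+ 2 * expR (- (2 * M) * t).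
pose dw t := 2 * z t ^+ 2 * (g t - M) * expR (- (2 * M) * t).
have dwE t : 0 <= t <= T -> is_derive t 1 w (dw t).
  move=> tT; have dzt := dz t tT.
  rewrite /w /dw.
  have de : is_derive t 1 (fun t => expR (- (2 * M) * t))
      (expR (- (2 * M) * t) * - (2 * M)).
    apply: (@is_derive1_comp _ expR (fun t => - (2 * M) * t)).
    have := is_deriveZ (- (2 * M)) (is_derive_id t 1).
    by rewrite /GRing.scale/= mulr1.
  have dz2 := is_derive_funX _ _ _ _ 1 dzt.
  apply: (is_derive_eq (is_derive_funM _ _ _ _ _ _ dz2 de)).
  by rewrite expr1; ring.
have tI t : t \in `]0, T[ -> 0 <= t <= T.
  by rewrite in_itv/= => /andP[/ltW-> /ltW->].
have : w T <= w 0.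
  apply: (ler0_derive1_le_cc (f := w) (a := 0) (b := T)).
  - by move=> t /tI/dwE[].
  - move=> t /tI tT; rewrite derive1E; have [_ ->] := dwE t tT.
    rewrite /dw -mulrA; apply: mulr_ge0_le0.
      by rewrite mulr_ge0// sqr_ge0.
    by rewrite mulr_le0_ge0 ?expR_ge0// subr_le0 gM// in_itv.
  - apply: derivable_within_continuous => t; rewrite in_itv/= => tT.
    by have [] := dwE t tT.
  - by rewrite in_itv/= lexx T0.
  - by rewrite in_itv/= lexx T0.
  - by [].
rewrite /w z0 expr0n/= mul0r => wT.
have : z T ^+ 2 <= 0 by rewrite -(pmulr_lle0 _ (expR_gt0 (- (2 * M) * T))).
by rewrite exprn_even_le0//= => /eqP.
Qed.

Lemma linear_ode_zero (I : set R) (z g : R -> R) : is_interval I -> I 0 ->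
  (forall t, I t -> is_derive t 1 z (z t * g t)) ->
  (forall t, I t -> {for t, continuous g}) ->
  z 0 = 0 -> forall t, I t -> z t = 0.
Proof.
move=> itvI I0 dz cg z0 t It.
have [t0|t0] := leP 0 t.
  apply: (linear_ode_forward z g) => // s /(itvI _ _ I0 It); first exact: dz.
  exact: cg.
(* [s |-> z (- s)] solves an equation of the same kind, with coefficient
   [- g (- s)]. *)
have Is s : 0 <= s <= - t -> I (- s).
  by move=> /andP[s0 st]; apply: (itvI _ _ It I0); rewrite lerNr st oppr_le0 s0.
rewrite -[t]opprK.
apply: (linear_ode_forward (z \o -%R) (fun s => - g (- s)))
  => [|s st|s st|].
- by rewrite oppr_ge0 ltW.
- have dzs := dz _ (Is _ st).
  have dzN := @is_derive1_comp _ z -%R s _ _ dzs (is_deriveNid s 1).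
  apply: (is_derive_eq dzN).
  by rewrite /= mulrN mulr1 mulrN.
- have cgN : {for s, continuous (fun s => g (- s))}.
    apply: (@continuous_comp _ _ _ -%R g); first exact: opp_continuous.
    exact: cg (Is _ st).
  exact: (continuousN cgN).
- by rewrite /= oppr0.
Qed.

(** Only the last coordinate matters: along a solution [phi] it satisfies
    [z' = z g] with [g] the cofactor of [z] in [R], evaluated at [phi]. *)
Lemma plane_invariant (k : coefficients R) :
  flow_invariant (field k) [set p : R3 | p.2 = 0].
Proof.
move=> I phi oI itvI I0 sol S0 t It /=.
have dphi s : I s -> differentiable phi s.
  by move=> /sol[? _]; apply/derivable1_diffP.
have cphi s : I s -> {for s, continuous phi}.
  by move=> Is; apply: differentiable_continuous; exact: dphi.
pose g (p : R3) := - 1 + 3 * c5 k * coordx p ^+ 2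
  + 6 * c6 k * coordx p * coordy p
  + 3 * c7 k * coordy p ^+ 2 + 3 * c8 k * coordx p * coordz p
  + 3 * c9 k * coordy p * coordz p + c10 k * coordz p ^+ 2.
have cg : continuous g.
  have C1g : C1_on setT g by rewrite /g; C1_auto.
  by move=> p; apply: differentiable_continuous; have [] := C1g p Logic.I.
apply: (linear_ode_zero I (fun s => coordz (phi s)) (g \o phi)) => // s Is.
- have dl : differentiable (@coordz R) (phi s).
    exact/linear_differentiable/coordz_continuous.
  have df := dphi _ Is.
  have [_ phiE] := sol _ Is.
  apply: DeriveDef; first exact/derivable1_diffP/differentiable_comp.
  rewrite deriveE; last exact: differentiable_comp.
  rewrite diff_comp// /= diff_lin; last exact: coordz_continuous.
  by rewrite -deriveE// phiE fieldE.
- by apply: continuous_comp; [exact: cphi|exact: cg].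
Qed.

End Invariance.

Theorem proposition3p10 (R : realType) :
  (forall k : coefficients R, coefficient_relations k ->
     density_function (field k) (@inverse_quartic R) /\
     flow_invariant (field k) [set p : R * R * R | p.2 = 0]) /\
  (exists k : coefficients R, coefficient_relations k /\
     exists U : set (R * R * R),
       [/\ open U, U !=set0 & forall p, U p -> 0 < divergence (field k) p]).
Proof.
split=> [k rk|]; last exact: positive_divergence_ex.
split; last exact: plane_invariant.
split.
- split; first exact: C1_field.
  rewrite fieldE /Defs.fieldP /fieldQ /fieldR /coordx /coordy /coordz /=.
  by congr (_, _, _); ring.
- exact: C1_inverse_quartic.
- by move=> p _; rewrite inverse_quarticE invr_ge0 sqr_ge0.
- by exists 1; [exact: ltr01|exact: integrable_inverse_quartic].
- apply: aeW => p p0.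
  have s0 : 0 < sqnorm p by rewrite lt_neqAle eq_sym sqnorm_neq0// sqnorm_ge0.
  by rewrite divergence_weighted_field// addr_gt0// invr_gt0// exprn_gt0.
Qed.
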